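(* Let $M,U\in\mathbb{R}^{p\times p}$ be symmetric, $M$ positive definite and $U$ positive semidefinite, let $1\le u\le d<p$, and let $\mathcal{E}=\mathcal{E}_M(U)$ be the $M$-envelope of $\mathrm{span}(U)$, of dimension $u$. Assume that $M$ has ordered eigenvalues with $\Delta=\min_{1\le j\le d}(\lambda_j-\lambda_{j+1})>0$ and that $\mathcal{E}\subseteq\mathrm{span}(v_1,\dots,v_d)$. Let $\Delta_U$ be the envelope score gap, $\nu=\|U\|_{op}$ and $\tau_0=\max_{1\le k\le d}\|v_k\|_1$. Let $\widehat M=X_n^{T}X_n$ for some $X_n\in\mathbb{R}^{n\times p}$, let $\widehat U\in\mathbb{R}^{p\times p}$ be symmetric positive semidefinite, and let $\widehat{\mathcal{E}}$ be the sparse NIECE subspace with $\ell_1$-bound $\tau$. Assume that $\tau>\tau_0$, $\|\widehat M-M\|_{\max}\le\epsilon$ and $\|\widehat U-U\|_{\max}\le\epsilon$. If $$\Delta_U>\sqrt{8c_0\nu^2\tau^2\epsilon}+(2c_0\nu+1)\tau^2\epsilon,$$ then there exists a constant $C>0$ that does not depend on $n$, $p$ or $\epsilon$ such that $$\|P_{\widehat{\mathcal{E}}}-P_{\mathcal{E}}\|_F^2\le C\,\epsilon\,\tau^2 .$$ (The constant $C$ may depend on $d$, $u$, $\Delta$, $\lambda_1,\dots,\lambda_d$, $\nu$ and $\Delta_U$.)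
   Context: $\|A\|_{\max}=\max_{i,j}|a_{ij}|$, $\|A\|_{op}$ is the spectral norm, $\|A\|_F$ the Frobenius norm; $P_{\mathcal{S}}$ is the orthogonal projection onto $\mathcal{S}$. $\lambda_1\ge\dots\ge\lambda_p$ are the eigenvalues of $M$ and $v_1,\dots,v_p$ corresponding orthonormal eigenvectors; $d$ is fixed. A reducing subspace of $M$ is a subspace $\mathcal{R}$ with $M=P_{\mathcal{R}}MP_{\mathcal{R}}+(I-P_{\mathcal{R}})M(I-P_{\mathcal{R}})$. $\mathcal{E}_M(U)$ is the intersection of all reducing subspaces of $M$ that contain the column space $\mathrm{span}(U)$. Envelope scores: $\phi_j=v_j^{T}Uv_j$, $j\le d$, sorted as $\phi_{(1)}\ge\dots\ge\phi_{(d)}$, with $v_{(j)}$ attaining $\phi_{(j)}$. Under the assumptions, $\mathcal{E}_M(U)=\mathrm{span}(v_{(1)},\dots,v_{(u)})$, exactly the first $u$ sorted scores are positive, and $\Delta_U=\phi_{(u)}>0$. PMD vectors of $\widehat M$ with bound $\tau$: set $\widehat M_1=\widehat M$; for $k=1,\dots,d$, $\widehat v_k$ is a maximizer of $v^{T}\widehat M_kv$ subject to $\|v\|_1\le\tau$ and $\|v\|_2^2\le1$, and $\widehat M_{k+1}=(I_p-\widehat v_k\widehat v_k^{T})\widehat M_k(I_p-\widehat v_k\widehat v_k^{T})$. Sparse NIECE subspace: compute $\widehat\phi_j=\widehat v_j^{T}\widehat U\widehat v_j$ for $j\le d$; $\widehat{\mathcal{E}}$ is the span of the $u$ vectors $\widehat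 v_j$ with the largest $\widehat\phi_j$. The constant $c_0$: a constant $c_0>0$, not depending on $n$, $p$ or $\epsilon$ (it may depend on $d,\Delta,\lambda_1,\dots,\lambda_d$), such that $\sin^2\Theta(v_k,\widehat v_k)\le c_0\epsilon\tau^2$ for $k=1,\dots,d$ whenever $\tau>\tau_0$ and $\|\widehat M-M\|_{\max}\le\epsilon$, where $\sin^2\Theta(v,w)=1-(v^{T}w)^2/(\|v\|_2^2\|w\|_2^2)$ (taken to be $1$ if $w=0$). *)

(* Defs.v *)
From HB Require Import structures.
From mathcomp Require Import all_boot all_order all_algebra.
From mathcomp Require Import all_classical all_reals all_analysis.

Set Implicit Arguments.
Unset Strict Implicit.
Unset Printing Implicit Defensive.

Import Order.TTheory GRing.Theory Num.Theory.

Local Open Scope classical_set_scope.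
Local Open Scope ring_scope.

(* Conventions: vectors of R^p are columns 'cV[R]_p; a subspace of R^p is a
   {vspace 'cV[R]_p}; families indexed by 1, 2, ... on paper are tuples indexed
   from 0, so that the j-th item is e`_j.-1. The max norm is the library's
   mx_norm. *)

Section Norms.
Variable R : realType.

Definition dot p (v w : 'cV[R]_p) : R := (v^T *m w) 0 0.

Definition quad p (A : 'M[R]_p) (v : 'cV[R]_p) : R := (v^T *m A *m v) 0 0.

Definition l1norm p (v : 'cV[R]_p) : R := \sum_i `|v i 0|.

Definition l2norm p (v : 'cV[R]_p) : R := Num.sqrt (dot v v).

Definition frobenius_norm m n (A : 'M[R]_(m, n)) : R :=
  Num.sqrt (\sum_i \sum_j A i j ^+ 2).

Definition opnorm m n (A : 'M[R]_(m, n)) : R :=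
  sup [set l2norm (A *m x) | x in [set x : 'cV[R]_n | l2norm x <= 1]].

(* The quotient is 0, hence sin2 v w = 1, when v = 0 or w = 0. *)
Definition sin2 p (v w : 'cV[R]_p) : R :=
  1 - dot v w ^+ 2 / (l2norm v ^+ 2 * l2norm w ^+ 2).

Definition posdefmx p (A : 'M[R]_p) : Prop :=
  A^T = A /\ forall x : 'cV[R]_p, x != 0 -> 0 < quad A x.

Definition possemidefmx p (A : 'M[R]_p) : Prop :=
  A^T = A /\ forall x : 'cV[R]_p, 0 <= quad A x.

End Norms.

Section Envelope.
Variables (R : realType) (p : nat).
Implicit Types (S : {vspace 'cV[R]_p}) (M U : 'M[R]_p).

Definition basis_mx S : 'M[R]_(p, \dim S) :=
  \matrix_(i, j) (tnth (vbasis S) j) i 0.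

(* B (B^T B)^-1 B^T, where the columns of B form a basis of S; it does not
   depend on the basis, see orthoprojT, orthoproj_id and orthoproj_mem. *)
Definition orthoproj S : 'M[R]_p :=
  basis_mx S *m invmx ((basis_mx S)^T *m basis_mx S) *m (basis_mx S)^T.

Lemma basis_mx_mul S (c : 'cV[R]_(\dim S)) :
  basis_mx S *m c = \sum_j c j 0 *: (vbasis S)`_j.
Proof.
apply/colP => i; rewrite !mxE summxE; apply: eq_bigr => j _.
by rewrite !mxE mulrC (tnth_nth 0).
Qed.

Lemma basis_mx_mem S (c : 'cV[R]_(\dim S)) : basis_mx S *m c \in S.
Proof.
rewrite basis_mx_mul; apply: rpred_sum => j _; apply: rpredZ.
by apply: vbasis_mem; rewrite mem_nth // size_tuple.
Qed.

Lemma dot_self_eq0 q (x : 'cV[R]_q) : x^T *m x = 0 -> x = 0.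
Proof.
move=> /matrixP /(_ 0 0); rewrite !mxE => /eqP.
rewrite psumr_eq0 => [/allP h|i _]; last by rewrite mxE -expr2 sqr_ge0.
apply/colP => i; rewrite mxE; apply/eqP.
by have := h i (mem_index_enum i); rewrite mxE -expr2 sqrf_eq0.
Qed.

Lemma gram_basis_unit S : (basis_mx S)^T *m basis_mx S \in unitmx.
Proof.
set G := _ *m _; rewrite -row_free_unit -kermx_eq0.
apply/eqP/row_matrixP => i; rewrite row0.
set r := row i _.
have : r *m G = 0 by rewrite /r -row_mul mulmx_ker row0.
move=> /(congr1 (fun w => w *m r^T)); rewrite mul0mx => rG.
have /dot_self_eq0 : (basis_mx S *m r^T)^T *m (basis_mx S *m r^T) = 0.
  by rewrite trmx_mul trmxK -rG /G !mulmxA.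
rewrite basis_mx_mul => h; apply/rowP => j; rewrite [RHS]mxE.
have /freeP/(_ (fun j => r^T j 0) h j) := basis_free (vbasisP S).
by rewrite mxE.
Qed.

Lemma orthoprojT S : (orthoproj S)^T = orthoproj S.
Proof.
by rewrite /orthoproj !trmx_mul trmx_inv trmx_mul !trmxK !mulmxA.
Qed.

Lemma orthoproj_mem S (x : 'cV[R]_p) : orthoproj S *m x \in S.
Proof. by rewrite /orthoproj -!mulmxA; exact: basis_mx_mem. Qed.

Lemma orthoproj_id S (x : 'cV[R]_p) : x \in S -> orthoproj S *m x = x.
Proof.
move=> xS; pose c := \col_j coord (vbasis S) j x.
have -> : x = basis_mx S *m c.
  rewrite basis_mx_mul {1}(coord_vbasis xS).
  by apply: eq_bigr => j _; rewrite mxE.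
by rewrite /orthoproj -!mulmxA (mulmxA _^T) mulKmx ?gram_basis_unit.
Qed.

Definition reducing M S : Prop :=
  let P := orthoproj S in
  M = P *m M *m P + (1%:M - P) *m M *m (1%:M - P).

Definition colspan U : {vspace 'cV[R]_p} := <<[seq col j U | j : 'I_p]>>%VS.

Definition is_envelope M U (E : {vspace 'cV[R]_p}) : Prop :=
  [set` E] = \bigcap_(S in [set S | reducing M S /\ (colspan U <= S)%VS]) [set` S].

End Envelope.

Section Spectral.
Variables (R : realType) (p : nat).
Implicit Types (M U : 'M[R]_p) (ev : p.-tuple R) (v : p.-tuple 'cV[R]_p).

(* The orthonormal basis makes ev the full list of eigenvalues of M, counted
   with multiplicity. *)
Definition spectral_decomposition M ev v : Prop :=
  [/\ sorted >=%R ev,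
      forall j : 'I_p, M *m tnth v j = tnth ev j *: tnth v j &
      forall i j : 'I_p, dot (tnth v i) (tnth v j) = (i == j)%:R].

(* For 0 < d < p; the default of the iterated minimum is its j = 0 term. *)
Definition eigengap d ev : R :=
  \big[Num.min/ev`_0 - ev`_1]_(j < d) (ev`_j - ev`_j.+1).

Definition max_l1norm d v : R := \big[Num.max/0]_(j < d) l1norm v`_j.

Definition envelope_scores d U v : seq R := mkseq (fun j => quad U v`_j) d.

(* The u-th largest score (1 <= u <= d). *)
Definition score_gap d u U v : R :=
  (sort >=%R (envelope_scores d U v))`_u.-1.

End Spectral.

Section SparseNiece.
Variables (R : realType) (p d : nat).
Implicit Types (A Mhat Uhat : 'M[R]_p) (vhat : d.-tuple 'cV[R]_p).

Definition pmd_feasible (tau : R) (v : 'cV[R]_p) : Prop :=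
  l1norm v <= tau /\ l2norm v ^+ 2 <= 1.

Definition deflate A (v : 'cV[R]_p) : 'M[R]_p :=
  (1%:M - v *m v^T) *m A *m (1%:M - v *m v^T).

Fixpoint pmd_mx Mhat vhat (k : nat) : 'M[R]_p :=
  if k is k'.+1 then deflate (pmd_mx Mhat vhat k') vhat`_k' else Mhat.

Definition is_pmd Mhat (tau : R) vhat : Prop :=
  forall k, (k < d)%N ->
    pmd_feasible tau vhat`_k /\
    forall w, pmd_feasible tau w ->
      quad (pmd_mx Mhat vhat k) w <= quad (pmd_mx Mhat vhat k) vhat`_k.

(* J is any set of u indices with the largest scores: ties may be broken
   arbitrarily. *)
Definition is_sparse_niece (u : nat) Uhat vhat (Ehat : {vspace 'cV[R]_p}) : Prop :=
  exists J : {set 'I_d},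
    [/\ #|J| = u,
        forall i j, i \in J -> j \notin J ->
          quad Uhat (tnth vhat j) <= quad Uhat (tnth vhat i) &
        Ehat = <<[seq tnth vhat j | j in J]>>%VS].

End SparseNiece.

(* c0 depends only on d, the leading eigenvalues lam and their gap Delta: it
   serves all n, p, eps and tau, and all M with these eigenvalues. *)
Definition pmd_rate_constant (R : realType) (d : nat) (lam : d.-tuple R)
    (Delta c0 : R) : Prop :=
  0 < c0 /\
  forall (n p : nat) (M : 'M[R]_p) (ev : p.-tuple R) (v : p.-tuple 'cV[R]_p)
    (X : 'M[R]_(n, p)) (vhat : d.-tuple 'cV[R]_p) (tau eps : R),
    (d < p)%N -> posdefmx M -> spectral_decomposition M ev v ->
    take d ev = lam -> eigengap d ev = Delta ->
    is_pmd (X^T *m X) tau vhat ->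
    max_l1norm d v < tau -> mx_norm (X^T *m X - M) <= eps ->
    forall k, (k < d)%N -> sin2 v`_k vhat`_k <= c0 * eps * tau ^+ 2.

(* Main.v *)
Require Import Defs.
From mathcomp Require Import all_boot all_order all_algebra.
From mathcomp Require Import all_classical all_reals all_analysis.
From mathcomp Require Import ring lra.

(** Since the d leading eigenvalues are simple, a reducing subspace that
    contains span(U) either contains a leading v_j or is orthogonal to it, and
    in the second case U v_j = 0. Hence the envelope is the span of the leading
    v_j with U v_j <> 0, exactly u of them, with scores at least Delta_U.

    For orthogonal projections, |P - Q|_F^2 = dim P + dim Q - 2 tr(Q P). With Q
    the projection on the envelope, the trace is the sum of |P v_j|^2 over the u
    selected indices, and |P v_j|^2 >= cos^2(v_j, vhat_j) as soon as vhat_j lies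
    in the range of P. So the squared distance is at most 2 u c0 eps tau^2
    whenever the estimated scores select the right indices; otherwise it is at
    most 2 u, which suffices if eps tau^2 is bounded below.

    When eps tau^2 is small the selection is right because estimated scores off
    the envelope are small while those on it are not. The vhat_j need not be
    unit vectors, so the latter requires a lower bound on |vhat_j|, which
    follows from comparing the PMD objective at vhat_j and at v_j. *)

Set Implicit Arguments.
Unset Strict Implicit.
Unset Printing Implicit Defensive.

Import Order.TTheory GRing.Theory Num.Theory.
Local Open Scope ring_scope.

(** * The inner product, quadratic forms and semidefinite matrices *)

Section Dot.
Variables (R : realType) (p : nat).
Implicit Types (x y z : 'cV[R]_p) (A B : 'M[R]_p).

Lemma dotE x y : dot x y = \sum_i x i 0 * y i 0.
Proof. by rewrite /dot mxE; apply: eq_bigr => i _; rewrite mxE. Qed.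

Lemma dotC x y : dot x y = dot y x.
Proof. by rewrite !dotE; apply: eq_bigr => i _; rewrite mulrC. Qed.

Lemma dotDr x y z : dot x (y + z) = dot x y + dot x z.
Proof. by rewrite /dot mulmxDr mxE. Qed.

Lemma dotDl x y z : dot (y + z) x = dot y x + dot z x.
Proof. by rewrite dotC dotDr !(dotC x). Qed.

Lemma dotZr a x y : dot x (a *: y) = a * dot x y.
Proof. by rewrite /dot -scalemxAr mxE. Qed.

Lemma dotZl a x y : dot (a *: y) x = a * dot y x.
Proof. by rewrite dotC dotZr dotC. Qed.

Lemma dotNr x y : dot x (- y) = - dot x y.
Proof. by rewrite -scaleN1r dotZr mulN1r. Qed.

Lemma dotBr x y z : dot x (y - z) = dot x y - dot x z.
Proof. by rewrite dotDr dotNr. Qed.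

Lemma dotBl x y z : dot (y - z) x = dot y x - dot z x.
Proof. by rewrite dotC dotBr !(dotC x). Qed.

Lemma dot0r x : dot x 0 = 0.
Proof. by rewrite /dot mulmx0 mxE. Qed.

Lemma dot_sumr I (r : seq I) (P : pred I) x (F : I -> 'cV[R]_p) :
  dot x (\sum_(i <- r | P i) F i) = \sum_(i <- r | P i) dot x (F i).
Proof.
by elim/big_rec2 : _ => [|i a b _ <-]; rewrite ?dot0r // dotDr.
Qed.

Lemma dot_ge0 x : 0 <= dot x x.
Proof. by rewrite dotE sumr_ge0 // => i _; rewrite -expr2 sqr_ge0. Qed.

Lemma dot_eq0 x : dot x x = 0 -> x = 0.
Proof.
move=> h; apply: dot_self_eq0; apply/matrixP => i j.
by rewrite !ord1 [RHS]mxE.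
Qed.

Lemma l2norm_sqr x : l2norm x ^+ 2 = dot x x.
Proof. by rewrite /l2norm sqr_sqrtr // dot_ge0. Qed.

Lemma dot_mulmxl A x y : dot (A *m x) y = dot x (A^T *m y).
Proof. by rewrite /dot trmx_mul mulmxA. Qed.

Lemma quadE A x : quad A x = dot x (A *m x).
Proof. by rewrite /quad /dot mulmxA. Qed.

Lemma cauchy_schwarz x y : dot x y ^+ 2 <= dot x x * dot y y.
Proof.
have [/eqP y0|y0] := boolP (dot y y == 0).
  by rewrite (dot_eq0 y0) !dot0r expr0n mulr0.
have yP : 0 < dot y y by rewrite lt_def y0 dot_ge0.
(* This vector is [dot y y] times the residual of [x] along [y], which avoids a division. *)
have := dot_ge0 (dot y y *: x - dot x y *: y).
rewrite dotBl !dotBr !dotZl !dotZr (dotC y x) => h.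
by rewrite -subr_ge0 -(pmulr_rge0 _ yP); lra.
Qed.

Lemma quadB A B x : quad (A - B) x = quad A x - quad B x.
Proof. by rewrite !quadE mulmxBl dotBr. Qed.

Lemma normr_quad_le A x : `|quad A x| <= mx_norm A * l1norm x ^+ 2.
Proof.
rewrite quadE dotE; apply: le_trans (ler_norm_sum _ _ _) _.
rewrite expr2 mulrA {2}/l1norm mulr_sumr; apply: ler_sum => i _.
rewrite normrM mulrC ler_wpM2r //.
rewrite mxE; apply: le_trans (ler_norm_sum _ _ _) _.
rewrite /l1norm mulr_sumr; apply: ler_sum => j _.
rewrite normrM ler_wpM2r // mx_normrE.
exact: (le_bigmax _ (fun k : 'I_p * 'I_p => `|A k.1 k.2|) (i, j)).
Qed.

(** Moving from [x] in the direction [y = A x] changes the form by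
    [2 * k * dot y y + k ^+ 2 * quad A y], which is negative for a small negative [k] unless
    [y = 0]. *)
Lemma possemidef_quad0 A x : possemidefmx A -> quad A x = 0 -> A *m x = 0.
Proof.
move=> [At A0] x0; apply: dot_eq0; apply/eqP; rewrite eq_le dot_ge0 andbT.
set y := A *m x; rewrite leNgt; apply/negP => yP.
have q0 := A0 y; set q := quad A y in q0.
have h k : 0 <= 2 * k * dot y y + k ^+ 2 * q.
  have := A0 (x + k *: y); rewrite quadE mulmxDr -scalemxAr dotDl !dotDr.
  rewrite !dotZl !dotZr -/y -quadE x0 -quadE -/q.
  by rewrite -[dot x (A *m y)]/(dot x _) -{1}At -dot_mulmxl -/y; lra.
move: (dot y y) yP h => c cP h; clearbody q; clear At A0 x0 y.
(* Adding 1 to [q] keeps the denominator positive even when [q = 0]. *)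
have := h (- (c / (q + 1))).
have -> : 2 * - (c / (q + 1)) * c
   + (- (c / (q + 1))) ^+ 2 * q = - (c / (q + 1)) ^+ 2 * (q + 2).
  by field; lra.
rewrite mulNr oppr_ge0 leNgt mulr_gt0 //; last by lra.
by rewrite exprn_gt0 // divr_gt0 //; lra.
Qed.

(* This is the parallelogram bound [quad A x <= 2 quad A (x + y) + 2 quad A y]. *)
Lemma possemidef_quadD_ge A x y :
  possemidefmx A -> quad A x / 2 - quad A y <= quad A (x + y).
Proof.
move=> [At A0]; have := A0 (x + 2 *: y).
rewrite !quadE !mulmxDr -scalemxAr !dotDl !dotDr !dotZl !dotZr.
have -> : dot y (A *m x) = dot x (A *m y) by rewrite -{2}At -dot_mulmxl dotC.
lra.
Qed.

End Dot.

(** * The spectral norm as a bound on quadratic forms *)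

Section OpNorm.
Variable R : realType.

(** Cauchy-Schwarz row by row. This bounds the set in the definition of [opnorm], so that its [sup]
    is a genuine least upper bound. *)
Lemma l2norm_mulmx_bounded m n (A : 'M[R]_(m, n)) (x : 'cV[R]_n) :
  l2norm x <= 1 -> l2norm (A *m x) <= frobenius_norm A.
Proof.
move=> x1; rewrite /l2norm /frobenius_norm ler_wsqrtr // dotE.
apply: ler_sum => i _; rewrite -expr2.
have -> : (A *m x) i 0 = dot (row i A)^T x.
  by rewrite dotE mxE; apply: eq_bigr => j _; rewrite !mxE.
apply: le_trans (cauchy_schwarz _ _) _.
have -> : \sum_j A i j ^+ 2 = dot (row i A)^T (row i A)^T.
  by rewrite dotE; apply: eq_bigr => j _; rewrite !mxE expr2.
rewrite ler_piMr ?dot_ge0 // -l2norm_sqr expr_le1 //; exact: sqrtr_ge0.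
Qed.

Lemma opnorm_ge m n (A : 'M[R]_(m, n)) (x : 'cV[R]_n) :
  l2norm x <= 1 -> l2norm (A *m x) <= opnorm A.
Proof.
move=> x1; apply: ub_le_sup; last by exists x.
by exists (frobenius_norm A) => _ [y y1 <-]; exact: l2norm_mulmx_bounded.
Qed.

Lemma opnorm_ge0 m n (A : 'M[R]_(m, n)) : 0 <= opnorm A.
Proof.
apply: le_trans (opnorm_ge A (x := 0) _); first exact: sqrtr_ge0.
by rewrite /l2norm dot0r sqrtr0.
Qed.

Lemma quad_le_opnorm p (A : 'M[R]_p) (x : 'cV[R]_p) :
  quad A x <= opnorm A * dot x x.
Proof.
have [/eqP x0|x0] := boolP (dot x x == 0).
  by rewrite quadE (dot_eq0 x0) mulmx0 !dot0r mulr0.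
have xP : 0 < dot x x by rewrite lt_def x0 dot_ge0.
have nP : 0 < l2norm x by rewrite /l2norm sqrtr_gt0.
set y := (l2norm x)^-1 *: x.
have y1 : dot y y = 1.
  by rewrite dotZl dotZr -l2norm_sqr; field; rewrite gt_eqF.
have xy : x = l2norm x *: y by rewrite scalerA divff ?scale1r // gt_eqF.
move: (l2norm x) nP xy => s sP; clearbody y; move=> ->.
rewrite quadE -scalemxAr !dotZl !dotZr y1 mulr1 mulrA mulrC.
rewrite ler_wpM2r //; first by rewrite mulr_ge0 // ltW.
have ny : l2norm y <= 1 by rewrite /l2norm y1 sqrtr1.
apply: le_trans (opnorm_ge A ny).
apply: le_trans (ler_norm _) _; rewrite -sqrtr_sqr /l2norm ler_wsqrtr //.
by apply: le_trans (cauchy_schwarz _ _) _; rewrite y1 mul1r.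
Qed.

End OpNorm.

(** * Orthogonal projections, their traces and Frobenius distances *)

Section Orthoproj.
Variables (R : realType) (p : nat).
Implicit Types S T : {vspace 'cV[R]_p}.

Lemma matrix_eq_cV m n (A B : 'M[R]_(m, n)) :
  (forall x : 'cV[R]_n, A *m x = B *m x) -> A = B.
Proof.
by move=> h; apply/matrixP => i j; move/colP/(_ i): (h (delta_mx j 0)); rewrite -!colE !mxE.
Qed.

Lemma orthoproj_idem S : orthoproj S *m orthoproj S = orthoproj S.
Proof.
apply: matrix_eq_cV => x.
by rewrite -mulmxA orthoproj_id // orthoproj_mem.
Qed.

Lemma dot_orthoproj S x y : dot (orthoproj S *m x) y = dot x (orthoproj S *m y).
Proof. by rewrite dot_mulmxl orthoprojT. Qed.

Lemma orthoproj_orth S x : (forall y, y \in S -> dot y x = 0) -> orthoproj S *m x = 0.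
Proof.
move=> h; apply: dot_eq0; rewrite dot_orthoproj mulmxA orthoproj_idem dotC.
by rewrite h // orthoproj_mem.
Qed.

Lemma mxtrace_orthoproj S : \tr (orthoproj S) = (\dim S)%:R.
Proof.
by rewrite /orthoproj -mulmxA mxtrace_mulC -mulmxA mulVmx ?gram_basis_unit // mxtrace1.
Qed.

Lemma frobenius_norm_sqr m n (A : 'M[R]_(m, n)) :
  frobenius_norm A ^+ 2 = \tr (A^T *m A).
Proof.
rewrite /frobenius_norm sqr_sqrtr; last first.
  by apply: sumr_ge0 => i _; apply: sumr_ge0 => j _; exact: sqr_ge0.
rewrite exchange_big /mxtrace; apply: eq_bigr => j _; rewrite mxE.
by apply: eq_bigr => i _; rewrite mxE expr2.
Qed.

Lemma frobenius_orthoprojB S T :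
  frobenius_norm (orthoproj S - orthoproj T) ^+ 2 =
  (\dim S)%:R + (\dim T)%:R - 2 * \tr (orthoproj T *m orthoproj S).
Proof.
rewrite frobenius_norm_sqr [(_ - _)^T]raddfB /= !orthoprojT mulmxBl !mulmxBr.
rewrite !orthoproj_idem !raddfB /= !mxtrace_orthoproj.
rewrite (mxtrace_mulC (orthoproj S)); ring.
Qed.

End Orthoproj.

(** Either condition says that the off-diagonal blocks [P M (1 - P)] and [(1 - P) M P] vanish. *)
Lemma reducingP (R : realType) p (M : 'M[R]_p) S :
  reducing M S <-> orthoproj S *m M = M *m orthoproj S.
Proof.
rewrite /reducing /=; set P := orthoproj S; have PP : P *m P = P := orthoproj_idem S.
have PQ : P *m (1%:M - P) = 0 by rewrite mulmxBr mulmx1 PP subrr.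
have QP : (1%:M - P) *m P = 0 by rewrite mulmxBl mul1mx PP subrr.
set Q := 1%:M - P in PQ QP *; have PQ1 : P + Q = 1%:M by rewrite addrC subrK.
clearbody Q P.
split=> [->|PM].
  rewrite mulmxDr mulmxDl !mulmxA PP PQ !mul0mx addr0.
  by rewrite -(mulmxA _ P P) PP -(mulmxA _ Q P) QP mulmx0 addr0.
have PMQ : P *m M *m Q = 0 by rewrite PM -mulmxA PQ mulmx0.
have QMP : Q *m M *m P = 0 by rewrite -mulmxA -PM mulmxA QP mul0mx.
rewrite -[LHS]mul1mx -[LHS]mulmx1 -PQ1 mulmxDr !mulmxDl PMQ QMP addr0 add0r.
by [].
Qed.

(** * Orthonormal bases and the subspaces spanned by some of their vectors *)

Section Orthonormal.
Variables (R : realType) (p : nat) (e : 'I_p -> 'cV[R]_p).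
Hypothesis eO : forall i j, dot (e i) (e j) = (i == j)%:R.
Implicit Types (x y : 'cV[R]_p) (A : 'M[R]_p) (K : {set 'I_p}).

(** The square matrix [V] with columns [e i] satisfies [V^T V = 1], hence also [V V^T = 1]; the
    latter applied to [x] is the expansion. *)
Lemma orthonormal_expand x : x = \sum_i dot (e i) x *: e i.
Proof.
pose V := \matrix_(i, j) e j i 0.
have VV : V^T *m V = 1%:M.
  apply/matrixP => i j; rewrite [RHS]mxE -eO dotE mxE.
  by apply: eq_bigr => k _; rewrite !mxE.
rewrite -[LHS]mul1mx -(mulmx1C VV) -mulmxA.
apply/colP => i; rewrite summxE mxE; apply: eq_bigr => j _.
rewrite [RHS]mxE mulrC dotE !mxE; congr (_ * _).
by apply: eq_bigr => k _; rewrite !mxE.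
Qed.

Lemma parseval x y : dot x y = \sum_i dot (e i) x * dot (e i) y.
Proof.
rewrite {1}(orthonormal_expand y) dot_sumr; apply: eq_bigr => i _.
by rewrite dotZr mulrC dotC.
Qed.

Lemma orthonormal_eq x y : (forall i, dot (e i) x = dot (e i) y) -> x = y.
Proof.
move=> h; rewrite (orthonormal_expand x) (orthonormal_expand y).
by apply: eq_bigr => i _; rewrite h.
Qed.

Lemma orthonormal_mx_eq A B : (forall i, A *m e i = B *m e i) -> A = B.
Proof.
move=> h; apply: matrix_eq_cV => x; rewrite (orthonormal_expand x) !mulmx_sumr.
by apply: eq_bigr => i _; rewrite -!scalemxAr h.
Qed.

Lemma mxtrace_orthonormal A : \tr A = \sum_i dot (e i) (A *m e i).
Proof.
pose V := \matrix_(i, j) e j i 0.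
have VV : V^T *m V = 1%:M.
  apply/matrixP => i j; rewrite [RHS]mxE -eO dotE mxE.
  by apply: eq_bigr => k _; rewrite !mxE.
rewrite -[A]mul1mx -{1}(mulmx1C VV) -mulmxA mxtrace_mulC.
apply: eq_bigr => i _; rewrite mul1mx dotE -mulmxA mxE.
apply: eq_bigr => k _; rewrite !mxE; congr (_ * _).
by apply: eq_bigr => m _; rewrite !mxE.
Qed.

Definition span_on K : {vspace 'cV[R]_p} := <<[seq e j | j in K]>>%VS.

Lemma span_onP K x :
  reflect (forall j, j \notin K -> dot (e j) x = 0) (x \in span_on K).
Proof.
apply: (iffP idP) => [xK j jK|h].
  have xS : x \in <<in_tuple [seq e k | k in K]>>%VS by [].
  rewrite (coord_span xS) dot_sumr big1 // => i _; rewrite dotZr.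
  have /fintype.imageP[k kK ->] : (in_tuple [seq e k | k in K])`_i \in [seq e k | k in K].
    exact/mem_nth.
  rewrite eO; case: eqP => [jk|]; last by rewrite mulr0.
  by rewrite jk kK in jK.
rewrite (orthonormal_expand x); apply: rpred_sum => i _.
have [iK|iK] := boolP (i \in K); last by rewrite h // scale0r mem0v.
by apply/rpredZ/memv_span/fintype.image_f.
Qed.

Lemma mem_span_on K j : j \in K -> e j \in span_on K.
Proof. by move=> jK; apply/memv_span/fintype.image_f. Qed.

Lemma orthoproj_span_on K j :
  orthoproj (span_on K) *m e j = (j \in K)%:R *: e j.
Proof.
have [jK|jK] := boolP (j \in K).
  by rewrite scale1r orthoproj_id // mem_span_on.
rewrite scale0r orthoproj_orth // => y /span_onP/(_ _ jK).
by rewrite dotC.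
Qed.

Lemma dim_span_on K : \dim (span_on K) = #|K|.
Proof.
apply/eqP; rewrite -(eqr_nat R) -mxtrace_orthoproj mxtrace_orthonormal.
rewrite (eq_bigr (fun j => (j \in K)%:R)) => [|j _]; last first.
  by rewrite orthoproj_span_on dotZr eO eqxx mulr1.
rewrite -natr_sum -sum1_card [X in _ == X%:R]big_mkcond /=.
by apply/eqP; congr _%:R; apply: eq_bigr => j _; case: (j \in K).
Qed.

(** The trace of the product of the projections is computed in the basis [e], where the projection
    on [span_on K] keeps the vectors indexed by [K] and kills the others. *)
Lemma frobenius_span_on K S :
  frobenius_norm (orthoproj S - orthoproj (span_on K)) ^+ 2 =
  (\dim S)%:R + #|K|%:R
    - 2 * \sum_(j in K) dot (orthoproj S *m e j) (orthoproj S *m e j).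
Proof.
rewrite frobenius_orthoprojB dim_span_on mxtrace_orthonormal [in RHS]big_mkcond /=.
congr (_ - 2 * _); apply: eq_bigr => j _.
rewrite -mulmxA -dot_orthoproj orthoproj_span_on dotZl.
rewrite dot_orthoproj mulmxA orthoproj_idem.
by case: ifP; rewrite ?mul1r ?mul0r.
Qed.

(** * Eigenbases, reducing subspaces and the envelope *)

Section Eigen.
Variables (M : 'M[R]_p) (l : 'I_p -> R).
Hypothesis (MT : M^T = M) (Me : forall j, M *m e j = l j *: e j).

Lemma dot_eigen j x : dot (e j) (M *m x) = l j * dot (e j) x.
Proof. by rewrite -{1}MT -dot_mulmxl Me dotZl. Qed.

Lemma quad_eigen x : quad M x = \sum_i l i * dot (e i) x ^+ 2.
Proof.
rewrite quadE parseval; apply: eq_bigr => i _; rewrite dot_eigen; ring.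
Qed.

Lemma quad_le_eigen b x : (forall i, l i <= b) -> quad M x <= b * dot x x.
Proof.
move=> lb; rewrite quad_eigen parseval mulr_sumr; apply: ler_sum => i _.
by rewrite -expr2 ler_wpM2r ?sqr_ge0.
Qed.

Lemma quad_ge_eigen j x :
  (forall i, 0 <= l i) -> l j * dot (e j) x ^+ 2 <= quad M x.
Proof.
move=> l0; rewrite quad_eigen (bigD1 j) //= lerDl sumr_ge0 // => i _.
by rewrite mulr_ge0 ?sqr_ge0.
Qed.

Lemma reducing_span_on K : reducing M (span_on K).
Proof.
apply/reducingP/orthonormal_mx_eq => j.
rewrite -[LHS]mulmxA -[RHS]mulmxA Me -scalemxAr !orthoproj_span_on -scalemxAr Me !scalerA.
by rewrite mulrC.
Qed.

(** The projection on [S] commutes with [M], so it preserves the eigenspace of [l j], which is a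
    line by simplicity. Thus it multiplies [e j] by a scalar [a], and the two cases are [a != 0] and
    [a = 0]. *)
Lemma reducing_simple_eigen S j : reducing M S -> (forall i, i != j -> l i != l j) ->
  e j \in S \/ forall x, x \in S -> dot (e j) x = 0.
Proof.
move=> /reducingP PM lj; set P := orthoproj S in PM.
have Pej : P *m e j = dot (e j) (P *m e j) *: e j.
  apply: orthonormal_eq => i; rewrite dotZr eO.
  case: eqVneq => [->|ij]; first by rewrite mulr1.
  have := dot_eigen i (P *m e j).
  rewrite mulmxA -PM -mulmxA Me -scalemxAr dotZr mulr0 => /eqP.
  rewrite -subr_eq0 -mulrBl mulf_eq0 subr_eq0 eq_sym (negbTE (lj i ij)) /=.
  by move/eqP.
set a := dot _ _ in Pej.
have [a0|a0] := eqVneq a 0; [right=> x xS|left].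
  by rewrite -(orthoproj_id xS) -dot_orthoproj -/P Pej a0 scale0r dotC dot0r.
rewrite -[e j](scalerK a0) memvZ // -Pej; exact: orthoproj_mem.
Qed.

Lemma colspan_mulmx U x : U *m x \in colspan U.
Proof.
have -> : U *m x = \sum_i x i 0 *: col i U.
  by apply/colP => k; rewrite summxE mxE; apply: eq_bigr => i _; rewrite !mxE mulrC.
by apply: rpred_sum => i _; apply/rpredZ/memv_span/map_f; rewrite mem_enum.
Qed.

(* Outside [K] the envelope is controlled by the hypothesis [E <= span_on K],
   inside by the reducing subspace spanned by the [e i], [i != j], which
   contains [colspan U] when [U *m e j = 0]. *)
Lemma envelope_span_on (U : 'M[R]_p) E K :
  U^T = U -> (forall i j, j \in K -> i != j -> l i != l j) ->
  is_envelope M U E -> (E <= span_on K)%VS ->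
  E = span_on [set j in K | U *m e j != 0].
Proof.
move=> UT lK envE EK; apply: subv_anti; apply/andP; split; last first.
  apply/subvP => x /span_onP xK.
  rewrite (orthonormal_expand x); apply: rpred_sum => j _.
  have [|/xK->] := boolP (j \in [set j in K | U *m e j != 0]); last first.
    by rewrite scale0r mem0v.
  rewrite inE => /andP[jK Uj]; apply: rpredZ.
  suff : [set` E]%classic (e j) by [].
  rewrite envE => S [redS US].
  have [//|jS] := reducing_simple_eigen redS (fun i => lK i j jK).
  (* In the orthogonal case [U (U e_j)] lies in [S], so the squared norm of [U e_j], which is the
     product of [e_j] with it, vanishes. *)
  case/eqP: Uj; apply: dot_eq0; rewrite dot_mulmxl UT jS //.
  exact/(subvP US)/colspan_mulmx.
apply/subvP => x xE; apply/span_onP => j; rewrite inE negb_and negbK.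
have [jK /= /eqP Uj|jK _] := boolP (j \in K); last first.
  exact: (span_onP _ _ (subvP EK _ xE)).
suff : x \in span_on [set~ j] by move/span_onP; apply; rewrite !inE eqxx.
have : [set` E]%classic x by [].
rewrite envE; apply; split; first exact: reducing_span_on.
apply/span_subvP => _ /mapP[i _ ->]; apply/span_onP => k.
rewrite !inE negbK => /eqP ->.
by rewrite colE -UT -dot_mulmxl Uj dotC dot0r.
Qed.

End Eigen.
End Orthonormal.

(** * Deflation and the norm of the PMD vectors *)

Section Pmd.
Variable R : realType.

Lemma l1norm_ge0 p (x : 'cV[R]_p) : 0 <= l1norm x.
Proof. exact: sumr_ge0. Qed.

Lemma l1normBZ p (x y : 'cV[R]_p) a :
  l1norm (x - a *: y) <= l1norm x + `|a| * l1norm y.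
Proof.
rewrite /l1norm mulr_sumr -big_split; apply: ler_sum => i _.
by rewrite !mxE -normrM; exact: ler_normB.
Qed.

Lemma quad_deflate p (A : 'M[R]_p) (v w : 'cV[R]_p) :
  quad (deflate A v) w = quad A (w - dot v w *: v).
Proof.
have vw : (1%:M - v *m v^T) *m w = w - dot v w *: v.
  rewrite mulmxBl mul1mx -mulmxA [v^T *m w]mx11_scalar -/(dot v w).
  by rewrite mul_mx_scalar.
rewrite !quadE /deflate -!mulmxA vw -{2}vw dot_mulmxl.
by rewrite [(_ - _)^T]raddfB /= trmx1 trmx_mul trmxK.
Qed.

Lemma quad_mx_norm p (A B : 'M[R]_p) eps x b :
  mx_norm (A - B) <= eps -> l1norm x <= b ->
  `|quad A x - quad B x| <= eps * b ^+ 2.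
Proof.
move=> AB xb; rewrite -quadB; apply: le_trans (normr_quad_le _ _) _.
apply: ler_pM; rewrite ?sqr_ge0 //.
  by rewrite mx_normrE bigmax_ge_id.
by rewrite lerXn2r // nnegrE ?l1norm_ge0 // (le_trans (l1norm_ge0 x)).
Qed.

(* [y] is the image of [w] under the successive maps
   [z |-> z - dot vhat`_i z *: vhat`_i], for [i] from [k.-1] down to [0]. *)
Lemma pmd_mx_deflation p d (A : 'M[R]_p) (vhat : d.-tuple 'cV[R]_p) tau k w :
  (forall i, (i < k)%N -> pmd_feasible tau vhat`_i) -> dot w w <= 1 ->
  exists y, [/\ quad (pmd_mx A vhat k) w = quad A y,
    l1norm y <= l1norm w + k%:R * tau, dot y y <= dot w w &
    forall x s, (forall i, (i < k)%N -> `|dot x vhat`_i| <= s) ->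
      dot x w - k%:R * s <= dot x y].
Proof.
elim: k w => [|k IHk] w feas w1.
  by exists w; split=> // [|x s _]; rewrite mul0r ?addr0 ?subr0.
have [vtau] := feas k (ltnSn k); rewrite l2norm_sqr.
set v := vhat`_k => v1; pose c := dot v w.
have c1 : `|c| <= 1.
  rewrite -(@expr_le1 _ 2) // -normrX ger0_norm ?sqr_ge0 //.
  by apply: le_trans (cauchy_schwarz _ _) _; rewrite mulr_ile1 ?dot_ge0.
(* As [v] need not be a unit vector, deflation need not be a projection; [dot v v <= 1] still makes
   it a contraction. *)
have ww : dot (w - c *: v) (w - c *: v) <= dot w w.
  rewrite dotBl !dotBr !dotZl !dotZr (dotC w v) -/c -subr_ge0.
  have -> : dot w w - (dot w w - c * c - (c * c - c * (c * dot v v)))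
    = c ^+ 2 * (2 - dot v v) by ring.
  by rewrite mulr_ge0 ?sqr_ge0 //; lra.
have [y [qy ly dy xy]] := IHk (w - c *: v)
  (fun i ik => feas i (ltnW ik)) (le_trans ww w1).
exists y; split; first by rewrite /= quad_deflate -/c -qy.
- apply: (le_trans ly); rewrite -natr1 mulrDl mul1r.
  have := l1normBZ w v c; have : `|c| * l1norm v <= tau.
    by apply: le_trans vtau; rewrite ler_piMl ?l1norm_ge0.
  lra.
- exact: le_trans ww.
move=> x s xs; apply: le_trans (xy x s (fun i ik => xs i (ltnW ik))).
have : c * dot x v <= s.
  apply: le_trans (ler_norm _) _; rewrite normrM.
  by apply: le_trans (xs k (ltnSn k)); rewrite ler_piMl.
rewrite -natr1 mulrDl mul1r dotBr dotZr; lra.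
Qed.

(** The deflated objective is at least as large at [vhat_k] as at [e j]. Undoing the deflation turns
    these two vectors into [z] and [y]. The component of [y] along [e j] is at least 1/2, so
    [quad M y >= l j / 4], while [quad M z] is at most [L] times the squared norm of [vhat_k]. The
    term in [eps] is the cost of replacing [A] by [M] at both. *)
Lemma pmd_norm_ge p d (e : 'I_p -> 'cV[R]_p) (M A : 'M[R]_p) (l : 'I_p -> R)
    (vhat : d.-tuple 'cV[R]_p) (L tau eps s : R) k j :
  (forall i j, dot (e i) (e j) = (i == j)%:R) ->
  M^T = M -> (forall i, M *m e i = l i *: e i) -> (forall i, 0 <= l i <= L) ->
  is_pmd A tau vhat -> mx_norm (A - M) <= eps -> (k < d)%N ->
  l1norm (e j) <= tau -> (forall i, (i < k)%N -> `|dot (e j) vhat`_i| <= s) ->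
  k%:R * s <= 2^-1 ->
  l j / 4 - 2 * (k.+1%:R ^+ 2 * (eps * tau ^+ 2)) <= L * dot vhat`_k vhat`_k.
Proof.
move=> eO MT Me lL pmd AM kd ejtau es ks.
have [[vtau v1] vmax] := pmd k kd.
rewrite l2norm_sqr in v1.
have feas i : (i < k)%N -> pmd_feasible tau vhat`_i.
  by move=> ik; have [] := pmd i (ltn_trans ik kd).
have ej1 : dot (e j) (e j) = 1 by rewrite eO eqxx.
have /vmax : pmd_feasible tau (e j) by split; rewrite // l2norm_sqr ej1.
have ej1' : dot (e j) (e j) <= 1 by rewrite ej1.
have [y [-> ly _ dy]] := @pmd_mx_deflation p d A vhat tau k (e j) feas ej1'.
have [z [-> lz dz _]] := @pmd_mx_deflation p d A vhat tau k vhat`_k feas v1.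
have {dy} : 2^-1 <= dot (e j) y by have := dy _ _ es; rewrite ej1; lra.
move=> ejy yz.
(* Each deflation adds at most [tau] to the l1 norm, so [k] of them leave it below [(k + 1) tau],
   which enters the error squared. *)
have b x : l1norm x <= k.+1%:R * tau ->
    `|quad A x - quad M x| <= k.+1%:R ^+ 2 * (eps * tau ^+ 2).
  by move=> /(quad_mx_norm AM); rewrite exprMn mulrCA.
have {}ly : l1norm y <= k.+1%:R * tau by rewrite -natr1 mulrDl mul1r; lra.
have {}lz : l1norm z <= k.+1%:R * tau by rewrite -natr1 mulrDl mul1r; lra.
have Mz : quad M z <= L * dot vhat`_k vhat`_k.
  have lL' i : l i <= L by case/andP: (lL i).
  apply: le_trans (quad_le_eigen eO MT Me z lL') _.
  by rewrite ler_wpM2l //; case/andP: (lL j) => /le_trans; exact.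
have My : l j / 4 <= quad M y.
  have l0 i : 0 <= l i by case/andP: (lL i).
  apply: le_trans (quad_ge_eigen eO MT Me j y l0).
  rewrite ler_wpM2l // (_ : 4^-1 = 2^-1 ^+ 2); last by field.
  by rewrite lerXn2r // nnegrE; lra.
have := b y ly; have := b z lz; rewrite !ler_norml => /andP[_ bz] /andP[by_ _].
lra.
Qed.

End Pmd.

(** * What a small angle implies for projections and scores *)

Section Angle.
Variables (R : realType) (p : nat).
Implicit Types (x y : 'cV[R]_p) (U : 'M[R]_p) (delta : R).

Lemma sin2_unit x y : dot x x = 1 -> sin2 x y = 1 - dot x y ^+ 2 / dot y y.
Proof. by move=> x1; rewrite /sin2 !l2norm_sqr x1 mul1r. Qed.

Lemma sin2_le_dot x y delta :
  dot x x = 1 -> sin2 x y <= delta -> dot y y * (1 - delta) <= dot x y ^+ 2.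
Proof.
move=> /sin2_unit ->; have [/eqP y0 _|y0] := boolP (dot y y == 0).
  by rewrite y0 mul0r sqr_ge0.
have yP : 0 < dot y y by rewrite lt_def y0 dot_ge0.
by move=> h; rewrite mulrC -ler_pdivlMr //; lra.
Qed.

(** The cosine is the length of the projection of the unit vector [x] on the line of [y], and
    projecting on the larger space [S] cannot give less. *)
Lemma sin2_le_orthoproj (S : {vspace 'cV[R]_p}) x y delta : y \in S ->
  dot x x = 1 -> sin2 x y <= delta ->
  1 - delta <= dot (orthoproj S *m x) (orthoproj S *m x).
Proof.
move=> yS /sin2_unit ->; set z := orthoproj S *m x.
have [/eqP ->|y0] := boolP (dot y y == 0).
  by rewrite invr0 mulr0 => h; apply: le_trans (dot_ge0 z); lra.
have yP : 0 < dot y y by rewrite lt_def y0 dot_ge0.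
suff : dot x y ^+ 2 / dot y y <= dot z z by lra.
rewrite ler_pdivrMr // -{1}(orthoproj_id yS) -dot_orthoproj.
exact: cauchy_schwarz.
Qed.

(** By Pythagoras the squared residual is [dot y y - dot x y ^+ 2], at most [delta * dot y y]. *)
Lemma dot_residual_le x y delta : dot x x = 1 -> dot y y <= 1 -> 0 <= delta ->
  dot y y * (1 - delta) <= dot x y ^+ 2 ->
  dot (y - dot x y *: x) (y - dot x y *: x) <= delta.
Proof.
move=> x1 y1 d0; rewrite dotBl !dotBr !dotZl !dotZr x1 (dotC y x).
have := ler_piMl d0 y1; lra.
Qed.

(** As [U] kills [x], only the residual of [y] contributes to its score. *)
Lemma quad_le_residual U x y delta :
  possemidefmx U -> dot x x = 1 -> dot y y <= 1 -> 0 <= delta ->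
  dot y y * (1 - delta) <= dot x y ^+ 2 -> U *m x = 0 ->
  quad U y <= opnorm U * delta.
Proof.
move=> [UT _] x1 y1 d0 xy Ux; set z := y - dot x y *: x.
have -> : quad U y = quad U z.
  rewrite !quadE mulmxBr -scalemxAr Ux scaler0 subr0 dotBl dotZl.
  by rewrite -{3}UT -dot_mulmxl Ux (dotC 0) dot0r mulr0 subr0.
apply: le_trans (quad_le_opnorm _ _) _.
by rewrite ler_wpM2l ?opnorm_ge0 // dot_residual_le.
Qed.

(** Here [y] is split into its component along [x] and the residual; the parallelogram bound removes
    the cross term at the cost of a factor 2. *)
Lemma quad_ge_residual U x y delta :
  possemidefmx U -> dot x x = 1 -> dot y y <= 1 -> 0 <= delta ->
  dot y y * (1 - delta) <= dot x y ^+ 2 ->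
  dot y y * (1 - delta) * quad U x / 2 - opnorm U * delta <= quad U y.
Proof.
move=> Upos x1 y1 d0 xy; set z := y - dot x y *: x.
have := possemidef_quadD_ge (dot x y *: x) z Upos.
have -> : dot x y *: x + z = y by rewrite addrC subrK.
apply: le_trans; apply: lerB.
  rewrite [quad U (_ *: _)]quadE -scalemxAr dotZl dotZr -quadE mulrA -expr2.
  by rewrite ler_wpM2r // ler_wpM2r // Upos.2.
apply: le_trans (quad_le_opnorm _ _) _.
by rewrite ler_wpM2l ?opnorm_ge0 // dot_residual_le.
Qed.

End Angle.

(** * Sorted scores and the selection of indices *)

Lemma count_mkseq T (a : pred T) (g : nat -> T) d :
  count a (mkseq g d) = #|[set j : 'I_d | a (g j)]|.
Proof.
rewrite -sum1_count big_map -{1}[d]subn0 -[iota _ _]/(index_iota 0 d) big_mkord.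
by rewrite sum1dep_card.
Qed.

(** The first [u] sorted entries are at least [D > 0] and so exhaust the [u] positive entries of
    [s]; a value strictly between 0 and [D] would be one more. *)
Lemma sorted_gap_le (R : realType) (s : seq R) u D x :
  (1 <= u)%N -> count (> 0) s = u -> (sort >=%R s)`_u.-1 = D -> 0 < D ->
  x \in s -> 0 < x -> D <= x.
Proof.
move=> u1 su sD D0 xs x0; rewrite leNgt; apply/negP => xD.
have us : (u <= size s)%N by rewrite -su count_size.
have uD : (u <= count (>= D) s)%N.
  have /permP <- := permEl (perm_sort >=%R s).
  have ut : size (take u (sort >=%R s)) = u.
    by rewrite size_takel // size_sort.
  rewrite -{1}ut -[X in count _ X](cat_take_drop u) count_cat.
  apply: leq_trans (leq_addr _ _).
  suff : all (>= D) (take u (sort >=%R s)) by rewrite all_count => /eqP ->.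
  apply/(all_nthP 0) => i; rewrite ut => iu; rewrite nth_take //= -sD.
  have ge_trans : transitive (>=%R : rel R) by move=> a b c /[swap]; exact: le_trans.
  apply: (sorted_leq_nth ge_trans).
  - by move=> a; exact: lexx.
  - by apply: sort_sorted => a b; exact: le_total.
  - by rewrite inE size_sort (leq_trans iu).
  - by rewrite inE size_sort prednK.
  - by rewrite -ltnS prednK.
suff : (count (>= D) s < count (> 0)%R s)%N by rewrite su ltnNge uD.
have sub : subpred (predU (>= D) (pred1 x)) (> 0).
  by move=> y /= /orP[/(lt_le_trans D0)|/eqP ->].
apply: leq_trans (sub_count sub s).
have := count_predUI (>= D) (pred1 x) s.
rewrite [count (predI _ _) _](eq_count (a2 := pred0)); last first.
  by move=> y /=; case: eqVneq => [->|]; rewrite ?andbF // leNgt xD.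
rewrite count_pred0 addn0 => ->; rewrite -addn1 leq_add2l.
by rewrite -has_count has_pred1.
Qed.

Lemma eigengap_le (R : realType) p d (ev : p.-tuple R) j :
  (j < d)%N -> eigengap d ev <= ev`_j - ev`_j.+1.
Proof.
move=> jd.
exact: (bigmin_le _ (Ordinal jd) (fun i : 'I_d => ev`_i - ev`_i.+1)).
Qed.

Lemma max_l1norm_ge (R : realType) p d (v : p.-tuple 'cV[R]_p) j :
  (j < d)%N -> l1norm v`_j <= max_l1norm d v.
Proof.
move=> jd.
exact: (le_bigmax _ (fun j : 'I_d => l1norm v`_j) (Ordinal jd)).
Qed.

(** If the selections differ, equal cardinality gives [i] in [J] outside [K] and [j] in [K] outside
    [J]. The estimated score of [y i] is at most [opnorm U * delta + eps * tau ^+ 2], and that of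
    [y j] at least [rho * D / 4] less the same amount, so [j] would beat [i]. *)
Lemma sparse_niece_selection (R : realType) p d (U Uhat : 'M[R]_p)
    (x y : 'I_d -> 'cV[R]_p) (K J : {set 'I_d}) (tau eps delta rho D : R) :
  possemidefmx U -> mx_norm (Uhat - U) <= eps ->
  (forall k, dot (x k) (x k) = 1) -> (forall k, pmd_feasible tau (y k)) ->
  (forall k, rho <= dot (y k) (y k)) -> 0 <= rho -> 0 <= delta <= 2^-1 ->
  (forall k, dot (y k) (y k) * (1 - delta) <= dot (x k) (y k) ^+ 2) ->
  0 <= D -> (forall k, k \in K -> D <= quad U (x k)) ->
  (forall k, k \notin K -> U *m x k = 0) ->
  2 * (opnorm U * delta + eps * tau ^+ 2) < rho * D / 4 ->
  #|J| = #|K| ->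
  (forall i j, i \in J -> j \notin J -> quad Uhat (y j) <= quad Uhat (y i)) ->
  J = K.
Proof.
move=> Upos UU x1 yfeas rhoy rho0 /andP[delta0 delta1] xy D0 KD KU sep JK Jmax.
have y1 k : dot (y k) (y k) <= 1 by rewrite -l2norm_sqr; case: (yfeas k).
have UyUhat k : `|quad Uhat (y k) - quad U (y k)| <= eps * tau ^+ 2.
  by apply: quad_mx_norm => //; case: (yfeas k).
apply/eqP; rewrite eqEcard JK leqnn andbT.
apply/fintype.subsetP => i iJ; apply: contraT => iK.
have [j jK jJ] : exists2 j, j \in K & j \notin J.
  apply/subsetPn; apply: contra iK => KJ.
  suff <- : J = K by [].
  by apply/esym/eqP; rewrite eqEcard KJ JK leqnn.
have := quad_le_residual Upos (x1 i) (y1 i) delta0 (xy i) (KU i iK).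
have := quad_ge_residual Upos (x1 j) (y1 j) delta0 (xy j).
(* The 4 combines [1 - delta >= 1/2] with the 2 of the parallelogram bound. *)
have : rho * D / 4 <= dot (y j) (y j) * (1 - delta) * quad U (x j) / 2.
  have : rho * 2^-1 <= dot (y j) (y j) * (1 - delta) by apply: ler_pM => //; lra.
  move=> rd; have : rho * 2^-1 * D <= dot (y j) (y j) * (1 - delta) * quad U (x j).
    by apply: ler_pM (KD j jK) => //; rewrite mulr_ge0 // invr_ge0.
  lra.
have := UyUhat i; have := UyUhat j; have := Jmax i j iJ jJ.
rewrite !ler_norml => ? /andP[? ?] /andP[? ?] ? ? ?.
exfalso; lra.
Qed.

(** * Leading eigenpairs, the envelope they span and its scores *)

Section Leading.
Variables (R : realType) (p d : nat) (M : 'M[R]_p) (ev : p.-tuple R).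
Variable v : p.-tuple 'cV[R]_p.
Hypotheses (dp : (d < p)%N) (specM : spectral_decomposition M ev v).

Lemma spectral_le i j : (i <= j < p)%N -> ev`_j <= ev`_i.
Proof.
move=> /andP[ij jp]; have [evs _ _] := specM.
have ge_trans : transitive (>=%R : rel R) by move=> a b c /[swap]; exact: le_trans.
have ge_refl : reflexive (>=%R : rel R) by move=> a; exact: lexx.
apply: (sorted_leq_nth ge_trans ge_refl 0 evs) => //; rewrite inE size_tuple //.
exact: leq_ltn_trans jp.
Qed.

Lemma spectral_simple (i j : 'I_p) :
  0 < eigengap d ev -> (j < d)%N -> i != j -> tnth ev i != tnth ev j.
Proof.
move=> gap0 jd; rewrite !(tnth_nth 0) -val_eqE neq_ltn => /orP[ij|ji].
  have := eigengap_le ev (ltn_trans ij jd).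
  have : ev`_j <= ev`_i.+1 by apply: spectral_le; rewrite ij ltn_ord.
  by move=> ? ?; rewrite gt_eqF //; lra.
have := eigengap_le ev jd.
have : ev`_i <= ev`_j.+1 by apply: spectral_le; rewrite ji ltn_ord.
by move=> ? ?; rewrite lt_eqF //; lra.
Qed.

Lemma spectral_gt0 (i : 'I_p) : posdefmx M -> 0 < tnth ev i.
Proof.
move=> [_ M0]; have [_ Mv vO] := specM.
have := M0 (tnth v i); rewrite quadE Mv dotZr vO eqxx mulr1; apply.
apply/eqP => v0; have := vO i i; rewrite v0 dot0r eqxx => /eqP.
by rewrite eq_sym oner_eq0.
Qed.

(** The next eigenvalue exists because [d < p], and it is positive. *)
Lemma eigengap_le_eigenvalue k : posdefmx M -> (k < d)%N -> eigengap d ev <= ev`_k.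
Proof.
move=> Mpos kd; have k1p : (k.+1 < p)%N := leq_ltn_trans kd dp.
have := spectral_gt0 (Ordinal k1p) Mpos; rewrite (tnth_nth 0) /=.
have := eigengap_le ev kd; lra.
Qed.

Lemma take_span_on : (<<take d v>> <= span_on (tnth v) [set j : 'I_p | (j < d)%N])%VS.
Proof.
apply/span_subvP => x /(nthP 0)[i]; rewrite size_takel ?size_tuple; last exact: ltnW.
move=> id; rewrite nth_take // => <-.
have ip := ltn_trans id dp.
by rewrite -[v`_i]/(v`_(Ordinal ip)) -tnth_nth mem_span_on // inE.
Qed.

End Leading.

Lemma envelope_leading (R : realType) p d (M U : 'M[R]_p) (ev : p.-tuple R)
    (v : p.-tuple 'cV[R]_p) E (dp : (d < p)%N) :
  posdefmx M -> U^T = U -> spectral_decomposition M ev v -> 0 < eigengap d ev ->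
  is_envelope M U E -> (E <= <<take d v>>)%VS ->
  E = span_on (tnth v)
    [set widen_ord (ltnW dp) k | k : 'I_d & U *m v`_k != 0].
Proof.
move=> [MT _] UT specM gap0 envE Ed; have [_ Mv vO] := specM.
have := envelope_span_on vO MT Mv UT _ envE
  (subv_trans Ed (take_span_on v dp)).
move=> -> => [|i j]; last by rewrite inE => jd; exact: (spectral_simple specM gap0).
congr span_on; apply/setP => j; rewrite !inE.
apply/andP/imsetP => [[jd Uj]|[k]].
  exists (Ordinal jd); last exact: val_inj.
  by rewrite inE /= -tnth_nth.
by rewrite inE => Uk ->; rewrite (tnth_nth 0) /= ltn_ord.
Qed.

(** For semidefinite [U] a score vanishes only if [U] kills the eigenvector, so exactly [u] scores
    are positive and the gap is the smallest of them. *)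
Lemma score_gap_le_quad (R : realType) p d u (U : 'M[R]_p) (v : p.-tuple 'cV[R]_p)
    (k : 'I_d) :
  (1 <= u)%N -> possemidefmx U -> #|[set k : 'I_d | U *m v`_k != 0]| = u ->
  0 < score_gap d u U v -> U *m v`_k != 0 -> score_gap d u U v <= quad U v`_k.
Proof.
move=> u1 Upos Ku gap0 Uk.
have quad_gt0 j : (0 < quad U v`_j) = (U *m v`_j != 0).
  rewrite lt_def Upos.2 andbT; congr (~~ _).
  apply/eqP/eqP => [/(possemidef_quad0 Upos)//|Uj].
  by rewrite quadE Uj dot0r.
apply: (@sorted_gap_le _ (envelope_scores d U v) u) => //; last by rewrite quad_gt0.
  rewrite count_mkseq -Ku; apply: eq_card => j.
  by rewrite !inE quad_gt0.
by apply/mapP; exists (val k); rewrite // mem_iota ltn_ord.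
Qed.

(** * The constant, and the regimes of large and small [eps * tau ^+ 2] *)

Theorem theorem4 (R : realType) (d u : nat) (lam : d.-tuple R)
    (Delta nu DeltaU c0 : R)
    (u_ge1 : (1 <= u)%N) (u_led : (u <= d)%N)
    (Delta_gt0 : 0 < Delta)
    (c0P : pmd_rate_constant lam Delta c0) :
  exists C : R, 0 < C /\
    forall (n p : nat) (M U : 'M[R]_p)
      (ev : p.-tuple R) (v : p.-tuple 'cV[R]_p) (E : {vspace 'cV[R]_p})
      (X : 'M[R]_(n, p)) (Uhat : 'M[R]_p)
      (vhat : d.-tuple 'cV[R]_p) (Ehat : {vspace 'cV[R]_p}) (tau eps : R),
    (d < p)%N ->
    posdefmx M -> possemidefmx U ->
    spectral_decomposition M ev v ->
    take d ev = lam ->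
    eigengap d ev = Delta ->
    is_envelope M U E ->
    \dim E = u ->
    (E <= <<take d v>>)%VS ->
    score_gap d u U v = DeltaU ->
    opnorm U = nu ->
    possemidefmx Uhat ->
    is_pmd (X^T *m X) tau vhat ->
    is_sparse_niece u Uhat vhat Ehat ->
    max_l1norm d v < tau ->
    mx_norm (X^T *m X - M) <= eps ->
    mx_norm (Uhat - U) <= eps ->
    Num.sqrt (8 * c0 * nu ^+ 2 * tau ^+ 2 * eps)
      + (2 * c0 * nu + 1) * tau ^+ 2 * eps < DeltaU ->
    frobenius_norm (orthoproj Ehat - orthoproj E) ^+ 2 <= C * eps * tau ^+ 2.
Proof.
have [c0_gt0 rate] := c0P.
(* [L] will bound all eigenvalues of [M], its form making it positive before any [M] is given; [rho]
   will bound the squared norms of the [vhat_k] from below. *)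
pose L := `|lam`_0| + Delta; pose rho := Delta / (8 * L).
pose m : R := d%:R.
(* The three terms of [K0 * t] being less than 1 bound respectively the angles
   between v_k and vhat_k, the loss in the norm of vhat_k, and the perturbation
   of the scores. *)
pose K0 := 4 * m ^+ 2 * c0 + 16 * m ^+ 2 / Delta
  + 8 * (`|nu| * c0 + 1) / (rho * `|DeltaU|).
have L_gt0 : 0 < L by rewrite ltr_wpDl.
have rho_gt0 : 0 < rho by rewrite divr_gt0 // mulr_gt0.
have d_ge1 : (1 <= d)%N := leq_trans u_ge1 u_led.
have m_ge1 : 1 <= m by rewrite /m ler1n.
have nuc0 : 0 <= `|nu| * c0 by rewrite mulr_ge0 // ltW.
have K01 : 0 <= 4 * m ^+ 2 * c0 by rewrite !mulr_ge0 ?sqr_ge0 // ltW.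
have K02 : 0 <= 16 * m ^+ 2 / Delta by rewrite !mulr_ge0 ?sqr_ge0 // invr_ge0 ltW.
have K03 : 0 <= 8 * (`|nu| * c0 + 1) / (rho * `|DeltaU|).
  by apply: divr_ge0; rewrite mulr_ge0 ?(ltW rho_gt0) // addr_ge0.
have K0_ge0 : 0 <= K0 by rewrite !addr_ge0.
(* [c0] serves small [eps * tau ^+ 2], [K0] large values, and the 1 gives strict positivity. *)
exists (2 * u%:R * (c0 + K0) + 1); split.
  by rewrite ltr_wpDl // !mulr_ge0 // addr_ge0 // ltW.
move=> n p M U ev v E X Uhat vhat Ehat tau eps dp Mpos Upos specM evlam gapD envE
  dimE Ed gapU nuE _ pmd [J [Ju Jmax EhatE]] tauM MX UU condU.
have [_ Mv vO] := specM.
have nu_ge0 : 0 <= nu by rewrite -nuE opnorm_ge0.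
have eps_ge0 : 0 <= eps by apply: le_trans MX; rewrite mx_normrE bigmax_ge_id.
set t := eps * tau ^+ 2.
have t_ge0 : 0 <= t by rewrite mulr_ge0 ?sqr_ge0.
have DeltaU_gt0 : 0 < DeltaU.
  apply: le_lt_trans condU; rewrite addr_ge0 ?sqrtr_ge0 //.
  apply: mulr_ge0 eps_ge0; apply: mulr_ge0; last exact: sqr_ge0.
  by rewrite addr_ge0 // !mulr_ge0 // ltW.
rewrite -mulrA -/t.
set K := [set k : 'I_d | U *m v`_k != 0].
have EK : E = span_on (tnth v) [set widen_ord (ltnW dp) k | k in K].
  by apply: envelope_leading (Mpos) Upos.1 specM _ envE Ed; rewrite gapD.
have winj : injective (widen_ord (ltnW dp)) by move=> i j [] /val_inj.
have Ku : #|K| = u by rewrite -(card_imset _ winj) -(dim_span_on vO) -EK.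
have vw (k : 'I_d) : tnth v (widen_ord (ltnW dp) k) = v`_k by rewrite (tnth_nth 0).
have v1 (k : 'I_d) : dot v`_k v`_k = 1 by rewrite -vw vO eqxx.
have vtau (k : 'I_d) : l1norm v`_k <= tau.
  by apply: le_trans (ltW tauM); exact: max_l1norm_ge.
have feas (k : 'I_d) : pmd_feasible tau vhat`_k by case: (pmd k (ltn_ord k)).
have vhat1 (k : 'I_d) : dot vhat`_k vhat`_k <= 1.
  by rewrite -l2norm_sqr; case: (feas k).
set delta := c0 * t.
have delta_ge0 : 0 <= delta by rewrite mulr_ge0 // ltW.
have sin2v (k : 'I_d) : sin2 v`_k vhat`_k <= delta.
  rewrite /delta mulrA; exact: (rate n p M ev v X vhat tau eps).
have vvhat (k : 'I_d) : dot vhat`_k vhat`_k * (1 - delta) <= dot v`_k vhat`_k ^+ 2.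
  exact: sin2_le_dot.
(* The selected [vhat_j] might be linearly dependent, so the dimension is only bounded above. *)
have dimEhat : (\dim Ehat <= u)%N.
  by rewrite EhatE -Ju cardE -(size_map (tnth vhat)); exact: dim_span.
rewrite EK frobenius_span_on // (card_imset _ winj) Ku big_imset /=; last first.
  by move=> i j _ _; exact: winj.
under eq_bigr do rewrite vw.
set Sigma := \sum_(_ in _) _.
have dimEhatR : (\dim Ehat)%:R <= u%:R :> R by rewrite ler_nat.
have u2 : 0 <= 2 * u%:R :> R by rewrite mulr_ge0.
have ud := mulr_ge0 u2 delta_ge0; rewrite /delta in ud.
have uK := mulr_ge0 u2 (mulr_ge0 K0_ge0 t_ge0).
have [big_t|small_t] := leP 1 (K0 * t).
  have Sigma0 : 0 <= Sigma by rewrite sumr_ge0 // => k _; exact: dot_ge0.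
  have : 2 * u%:R <= 2 * u%:R * (K0 * t) by rewrite ler_peMr.
  lra.
(* The squared distance is then at most [u + u - 2 u (1 - delta) = 2 u c0 t]. *)
suff Sigma_ge : u%:R * (1 - delta) <= Sigma.
  by rewrite /delta in Sigma_ge; lra.
suff JK : J = K.
  rewrite -Ku mulr_natl -sumr_const; apply: ler_sum => k kK.
  apply: sin2_le_orthoproj (v1 k) (sin2v k).
  rewrite EhatE JK -tnth_nth; apply/memv_span/fintype.image_f.
  by [].
have K0E : K0 * t = 4 * m ^+ 2 * c0 * t + 16 * m ^+ 2 / Delta * t
    + 8 * (`|nu| * c0 + 1) / (rho * `|DeltaU|) * t by rewrite !mulrDl.
have small1 : 4 * m ^+ 2 * c0 * t < 1.
  apply: le_lt_trans small_t; rewrite K0E.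
  by have := mulr_ge0 K02 t_ge0; have := mulr_ge0 K03 t_ge0; lra.
have small2 : 16 * m ^+ 2 / Delta * t < 1.
  apply: le_lt_trans small_t; rewrite K0E.
  by have := mulr_ge0 K01 t_ge0; have := mulr_ge0 K03 t_ge0; lra.
have small3 : 8 * (`|nu| * c0 + 1) / (rho * `|DeltaU|) * t < 1.
  apply: le_lt_trans small_t; rewrite K0E.
  by have := mulr_ge0 K01 t_ge0; have := mulr_ge0 K02 t_ge0; lra.
have delta_small : m ^+ 2 * delta <= 2^-1 ^+ 2 by rewrite /delta; lra.
have delta_half : delta <= 2^-1.
  have : delta <= m ^+ 2 * delta by rewrite ler_peMl // exprn_ege1.
  lra.
have rho_le (k : 'I_d) : rho <= dot vhat`_k vhat`_k.
  have evL i : 0 <= tnth ev i <= L.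
    rewrite ltW ?(spectral_gt0 specM) //=.
    have p0 : (0 < p)%N := leq_ltn_trans (leq0n d) dp.
    apply: (@le_trans _ _ ev`_0).
      by rewrite (tnth_nth 0); apply: (spectral_le specM); rewrite ltn_ord.
    rewrite (_ : ev`_0 = lam`_0) ?ler_wpDr // ?(ltW Delta_gt0) ?ler_norm //.
    by rewrite -evlam nth_take.
  (* Being orthogonal to [v_i], the vector [v_k] sees only the residual of [vhat_i] along [v_i],
     whose squared norm is at most [delta]. *)
  have s1 i : (i < k)%N -> `|dot (tnth v (widen_ord (ltnW dp) k)) vhat`_i|
      <= Num.sqrt delta.
    move=> ik; pose i' := Ordinal (ltn_trans ik (ltn_ord k)).
    rewrite -sqrtr_sqr ler_wsqrtr // vw -[vhat`_i]/(vhat`_i').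
    have := dot_residual_le (v1 i') (vhat1 i') delta_ge0 (vvhat i').
    set z := vhat`_i' - _; apply: le_trans.
    have -> : dot v`_k vhat`_i' = dot v`_k z.
      rewrite /z dotBr dotZr -!vw vO (_ : _ == _ = false) ?mulr0 ?subr0 //.
      by rewrite -val_eqE /= gtn_eqF.
    by apply: le_trans (cauchy_schwarz _ _) _; rewrite v1 mul1r.
  have km : k.+1%:R <= m by rewrite ler_nat.
  have ks : k%:R * Num.sqrt delta <= 2^-1.
    apply: (@le_trans _ _ (m * Num.sqrt delta)).
      by rewrite ler_wpM2r ?sqrtr_ge0 // ler_nat ltnW.
    rewrite -(@ler_pXn2r _ 2) // ?nnegrE ?invr_ge0 //.
      by rewrite exprMn sqr_sqrtr.
    by rewrite mulr_ge0 // sqrtr_ge0.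
  have := pmd_norm_ge vO Mpos.1 Mv evL pmd MX (ltn_ord k) _ s1 ks.
  rewrite vw (tnth_nth 0) /= -/t => /(_ (vtau k)) norm_ge.
  have Deltak : Delta <= ev`_k by rewrite -gapD (eigengap_le_eigenvalue dp specM).
  have kt : k.+1%:R ^+ 2 * t <= m ^+ 2 * t.
    by rewrite ler_wpM2r // lerXn2r // nnegrE ler0n.
  (* Half of [Delta / 4] absorbs the perturbation [2 m^2 t]; the other half, divided by [L], is
     [rho]. *)
  have mt : 16 * (m ^+ 2 * t) < Delta.
    by move: small2; rewrite mulrAC ltr_pdivrMr // mul1r mulrA.
  rewrite /rho ler_pdivrMr ?mulr_gt0 // mulrCA mulrC.
  lra.
apply: (sparse_niece_selection Upos UU (x := fun k => v`_k)
  (y := fun k => vhat`_k) (tau := tau) (delta := delta) (rho := rho) (D := DeltaU)).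
all: rewrite // ?(ltW rho_gt0) ?(ltW DeltaU_gt0) ?Ku //.
- by rewrite delta_ge0.
- move=> k; rewrite inE => Uk; rewrite -gapU.
  by apply: (score_gap_le_quad u_ge1) => //; rewrite gapU.
- by move=> k; rewrite inE negbK => /eqP.
(* Cleared of its denominator, [small3] is the separation of scores that the selection requires. *)
- rewrite (gtr0_norm DeltaU_gt0) (ger0_norm nu_ge0) mulrAC in small3.
  rewrite (ltr_pdivrMr _ _ (mulr_gt0 rho_gt0 DeltaU_gt0)) mul1r in small3.
  by rewrite nuE -/t /delta; lra.
- by move=> i j iJ jJ; rewrite -!tnth_nth; exact: Jmax.
Qed.
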